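(* Let $M=(M_I)_{I\in\mathcal{D}^4}$ be a bounded non-negative sliced dyadic supermartingale on $I_0=[0,1)$, and set $\mu=(\mu_I)_{I\in\mathcal{D}^4}$ with $\frac{\mu_I}{|I|}=-\Delta^{\mathrm{dy}}M_I$. Then there is the embedding from $H^2_{\mathrm{dy}}$ to $\ell^2(\mu)$: for all $f=u+iv\in H^2_{\mathrm{dy}}$, $$\sum_{I\in\mathcal{D}^4}\mu_I\,(u_I^2+v_I^2)\leqslant e\,\|M\|_\infty\,\|f\|^2_{H^2_{\mathrm{dy}}} .$$ Moreover the constant $e$ is sharp: for every $C<e$ there exist a bounded non-negative sliced dyadic supermartingale $M$, with associated sequence $\mu_I=-|I|\Delta^{\mathrm{dy}}M_I$, and $f=u+iv\in H^2_{\mathrm{dy}}$ such that $\sum_{I\in\mathcal{D}^4}\mu_I(u_I^2+v_I^2)>C\|M\|_\infty\|f\|^2_{H^2_{\mathrm{dy}}}$.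
   Context: Let $I_0=[0,1)$ and let $\mathcal{D}^4=\mathcal{D}^4(I_0)=\{[n4^{-k},(n+1)4^{-k}) : k\in\mathbb{N}_0,\ 0\leqslant n\leqslant 4^k-1\}$ be the 4-adic intervals. For an interval $I$ write $I_-$ and $I_+$ for its left and right halves. For $I\in\mathcal{D}^4$ set $I^y=I_-$ and $I^x=I_+$, and let $I^\star_-$, $I^\star_+$ be the left and right halves of $I^\star$, $\star\in\{x,y\}$; these are the four 4-adic children of $I$, each of length $|I|/4$. A real family $u=(u_I)_{I\in\mathcal{D}^4}$ is a sliced dyadic martingale if for all $I\in\mathcal{D}^4$ $$u_I=\frac{u_{I^x_+}+u_{I^x_-}}2=\frac{u_{I^y_+}+u_{I^y_-}}2 .$$ Its increments are $\Delta^\star u_I=\frac12(u_{I^\star_+}-u_{I^\star_-})$, $\star\in\{x,y\}$. If it is $L^2$ integrable, i.e. $\sup_n\sum_{I\in\mathcal{D}^4,|I|=4^{-n}}|I|u_I^2<\infty$, then it is identified with its $L^2$ limit $u\in L^2(I_0)$, so that $u_I=\langle u\rangle_I$ is the average of $u$ over $I$. The dyadic Hardy space $H^2_{\mathrm{dy}}$ consists of $f=u+iv$ with $u,v$ real-valued $L^2$ integrable sliced dyadic martingales satisfying the dyadic Cauchy–Riemann equations $\Delta^x u_I=\Delta^y v_I$, $\Delta^y u_I=-\Delta^x v_I$ for all $I\in\mathcal{D}^4$. Its norm is $\|f\|^2_{H^2_{\mathrm{dy}}}=\int_{I_0}(u^2+v^2)$. A sliced dyadic supermartingale is a real family $M=(M_I)_{I\in\mathcal{D}^4}$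 such that for all $I\in\mathcal{D}^4$ $$M_I\geqslant\frac{M_{I^x_+}+M_{I^x_-}}2=\frac{M_{I^y_+}+M_{I^y_-}}2 .$$ Its dyadic Laplacian is given by $-\Delta^{\mathrm{dy}}M_I=M_I-\frac12(M_{I^x_+}+M_{I^x_-})=M_I-\frac12(M_{I^y_+}+M_{I^y_-})\geqslant0$. It is non-negative if all $M_I\geqslant0$, and bounded if $\|M\|_\infty=\sup_{I\in\mathcal{D}^4}|M_I|<\infty$. *)

(* Defs.v *)
From HB Require Import structures.
From mathcomp Require Import all_boot all_order all_algebra.
From mathcomp Require Import all_classical all_reals all_analysis.

Set Implicit Arguments.
Unset Strict Implicit.
Unset Printing Implicit Defensive.
Import Order.TTheory GRing.Theory Num.Theory.
Import numFieldNormedType.Exports.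

Local Open Scope classical_set_scope.
Local Open Scope ring_scope.

(* The interval [n 4^-k, (n+1) 4^-k) of D^4([0,1)) is encoded by (k, n) with
   n < 4^k; distinct codes give distinct intervals. *)
Definition D4 : choiceType := {k : nat & 'I_(4 ^ k)}.

Definition level (I : D4) : nat := tag I.
Definition pos (I : D4) : nat := tagged I.

Lemma child_subproof (I : D4) (j : 'I_4) : (4 * pos I + j < 4 ^ (level I).+1)%N.
Proof.
rewrite expnS; apply: (@leq_trans (4 * (pos I).+1)%N).
  by rewrite mulnS addnC ltn_add2r.
by rewrite leq_mul2l /=; exact: ltn_ord.
Qed.

(* The four 4-adic children (quarters) of I, numbered from left to right. *)
Definition child (I : D4) (j : 'I_4) : D4 :=
  existT (fun k => 'I_(4 ^ k)) (level I).+1 (Ordinal (child_subproof I j)).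

(* I^y is the left half of I and I^x its right half. *)
Definition yminus (I : D4) : D4 := child I (@Ordinal 4 0 isT).
Definition yplus (I : D4) : D4 := child I (@Ordinal 4 1 isT).
Definition xminus (I : D4) : D4 := child I (@Ordinal 4 2 isT).
Definition xplus (I : D4) : D4 := child I (@Ordinal 4 3 isT).

Section SlicedDyadic.
Variable R : realType.
Implicit Types (I : D4) (u v M : D4 -> R).

Definition I0 : set R := `[0, 1[.

Definition len I : R := 4 ^- level I.

Definition itv I : set R :=
  [set` `[(pos I)%:R * len I, (pos I).+1%:R * len I[ ].

Definition sliced_martingale u : Prop := forall I,
  u I = (u (xplus I) + u (xminus I)) / 2 /\
  u I = (u (yplus I) + u (yminus I)) / 2.

Definition Dx u I : R := (u (xplus I) - u (xminus I)) / 2.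
Definition Dy u I : R := (u (yplus I) - u (yminus I)) / 2.

Definition generation (n : nat) (i : 'I_(4 ^ n)) : D4 :=
  existT (fun k => 'I_(4 ^ k)) n i.

Definition L2_integrable u : Prop :=
  (ereal_sup (range (fun n : nat =>
     (\sum_(i < 4 ^ n) len (generation i) * u (generation i) ^+ 2)%:E))
   < +oo)%E.

Definition step_fun u (n : nat) (x : R) : R :=
  \sum_(i < 4 ^ n) u (generation i) * \1_(itv (generation i)) x.

Definition is_L2_limit u (g : R -> R) : Prop :=
  [/\ measurable_fun I0 g,
      (\int[lebesgue_measure]_(x in I0) (g x ^+ 2)%:E < +oo)%E &
      (\int[lebesgue_measure]_(x in I0) ((step_fun u n x - g x) ^+ 2)%:E)%E
        @[n --> \oo] --> 0%E].

(* A representative of the L^2 limit. It is determined a.e. on [0,1), and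
   exists for every L^2 integrable sliced dyadic martingale; the default 0 is
   irrelevant then. *)
Definition L2_limit u : R -> R := xget (cst 0) [set g | is_L2_limit u g].

(* f = u + iv is represented by the pair of its real and imaginary parts. *)
Definition H2dy u v : Prop :=
  [/\ sliced_martingale u /\ L2_integrable u,
      sliced_martingale v /\ L2_integrable v &
      forall I, Dx u I = Dy v I /\ Dy u I = - Dx v I].

Definition H2dy_sqnorm u v : \bar R :=
  (\int[lebesgue_measure]_(x in I0) (L2_limit u x ^+ 2 + L2_limit v x ^+ 2)%:E)%E.

Definition sliced_supermartingale M : Prop := forall I,
  M I >= (M (xplus I) + M (xminus I)) / 2 /\
  (M (xplus I) + M (xminus I)) / 2 = (M (yplus I) + M (yminus I)) / 2.

Definition nonnegative M : Prop := forall I, 0 <= M I.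

Definition sup_norm M : \bar R := ereal_sup (range (fun I => `|M I|%:E)).

Definition bounded_family M : Prop := (sup_norm M < +oo)%E.

(* For a sliced dyadic supermartingale, the x and y children give the same
   value. *)
Definition laplacian M I : R := - (M I - (M (xplus I) + M (xminus I)) / 2).

Definition carleson_seq M I : R := len I * - laplacian M I.

Definition embedding_sum M u v : \bar R :=
  (\esum_(I in [set: D4]) (carleson_seq M I * (u I ^+ 2 + v I ^+ 2))%:E)%R.

End SlicedDyadic.

(* Main.v *)
Require Import Defs.
From mathcomp Require Import all_boot all_order all_algebra.
From mathcomp Require Import all_classical all_reals all_analysis measurable_realfun.
From mathcomp Require Import ring lra zify.
Import Order.TTheory GRing.Theory Num.Theory.
Import numFieldNormedType.Exports.
Local Open Scope classical_set_scope.
Local Open Scope ring_scope.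

Set Implicit Arguments.
Unset Strict Implicit.
Unset Printing Implicit Defensive.

(** The upper bound is a Bellman function argument. Normalise [0 <= M <= 1] and
    consider the potential [exp(1 - M) |f| ^ 2] with [f = u + i v]. The
    Cauchy-Riemann equations say that if [f] changes by [+w] and [-w] on the two
    x children, then it changes by [+i w] and [-i w] on the two y children. For
    such [f] the average of [exp(h) |f| ^ 2] over the four children, with [h] a
    sliced martingale, is at least its value at the parent
    ([exp_sqnorm_submean]; after minimising over [w] this is
    [(cosh a - 1) (cosh b - 1) >= 0]). A drop of [M] by [d = - laplacian M]
    multiplies the potential by [exp d >= 1 + d], so that from one generation to
    the next the expected potential grows by at least the Carleson terms of that
    generation ([carleson_potential_step]). Since the potential is non-negative
    and at most [e |f| ^ 2], the sum of all terms is at most [e] times the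
    supremum of the energies of the generations.

    That supremum is the squared norm in [H2dy] ([H2dy_sqnormE]): an L^2 bounded
    martingale converges in L^2, by orthogonality of increments, almost
    everywhere convergence of a fast subsequence and Fatou's lemma
    ([L2_limit_exists]), and norms pass to the limit.

    For sharpness all the inequalities above have to be nearly equalities: the
    Laplacian should act only where [M = 1], by a small amount, and [M] should
    otherwise move in one of the two directions x, y and end at 0. So let
    [K M] be a random walk on the heights [0, ..., K] that is absorbed at 0, and
    otherwise moves by one on the x children and rests on the y children, after
    a preliminary drop by one whenever it is at [K]; let [f] have the increments for which the
    submean inequality is an equality. Weighting by the potential, the total
    mass, the mean height and the mean square height of the walk satisfy explicit
    recursions ([mom_one], [mom_id], [mom_sqr_ge]). They show that the mean
    height tends to 0, that the Carleson sum is [1 / lam], and that the energy is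
    at most [exp(1 / K) / (e lam)], for the same constant
    [lam = K - (K - 1) exp(1 / K)]. The ratio [exp(1 - 1 / K)] tends to [e]. *)

(** * Parents, children and expectations on the tree *)

Lemma lt_mod_exp4 k n : (n %% 4 ^ k < 4 ^ k)%N.
Proof. by rewrite ltn_pmod ?expn_gt0. Qed.

(** Reducing the position modulo [4 ^ k] makes it a total function of two
    numbers, so that sums over a generation become sums over [nat]. *)
Definition node (k n : nat) : D4 :=
  existT (fun k => 'I_(4 ^ k)) k (Ordinal (lt_mod_exp4 k n)).

Lemma generationE n (i : 'I_(4 ^ n)) : generation i = node n i.
Proof. by congr existT; apply: val_inj; rewrite /= modn_small. Qed.

Lemma node_pos I : node (level I) (pos I) = I.
Proof. by case: I => k i; rewrite -generationE. Qed.

Lemma pos_lt I : (pos I < 4 ^ level I)%N.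
Proof. by case: I => k i; exact: ltn_ord. Qed.

Lemma pos_node k n : (n < 4 ^ k)%N -> pos (node k n) = n.
Proof. by move=> ?; rewrite /pos /= modn_small. Qed.

Lemma child_node k n j : (n < 4 ^ k)%N ->
  child (node k n) j = node k.+1 (4 * n + j).
Proof.
move=> nk; rewrite -[LHS]node_pos; congr node.
by rewrite /child /pos /= modn_small.
Qed.

Definition parent I : D4 := node (level I).-1 (pos I %/ 4).
(** Which of the four quarters of its parent an interval is. *)
Definition digit I : nat := (pos I %% 4)%N.

Lemma parent_child I j : parent (child I j) = I.
Proof.
rewrite -[RHS]node_pos /parent; congr node.
by rewrite /pos /= mulnC divnMDl// divn_small ?addn0// ltn_ord.
Qed.

Lemma digit_child I j : digit (child I j) = j.
Proof. by rewrite /digit /pos /= mulnC modnMDl modn_small. Qed.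

Section Expectation.
Variable R : realType.
Implicit Types F G : D4 -> R.

Definition expect (n : nat) F : R :=
  \sum_(i < 4 ^ n) len R (generation i) * F (generation i).

Lemma expectE n F : expect n F = 4 ^- n * \sum_(0 <= i < 4 ^ n) F (node n i).
Proof.
by rewrite big_mkord mulr_sumr; apply: eq_bigr => i _; rewrite -generationE.
Qed.

Lemma expect0 F : expect 0 F = F (node 0 0).
Proof. by rewrite expectE expr0 invr1 mul1r expn0 big_nat1. Qed.

Definition child_avg F I : R :=
  (F (xplus I) + F (xminus I) + F (yplus I) + F (yminus I)) / 4.

(** Each interval of generation [n] has four children of a quarter of its
    length; this turns every monotonicity in [n] into an inequality between
    an interval and its children. *)
Lemma expectS n F : expect n.+1 F = expect n (child_avg F).
Proof.
rewrite !expectE expnSr big_nat_mul exprSr invfM -mulrA; congr (_ * _).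
rewrite mulr_sumr big_nat [in RHS]big_nat; apply: eq_bigr => i /= ilt.
rewrite /child_avg /xplus /xminus /yplus /yminus !child_node//=.
have -> : (i.+1 * 4 = 4 + 4 * i)%N by rewrite mulSn mulnC.
rewrite (mulnC i) -{1}[(4 * i)%N]add0n big_addn addnK.
rewrite !big_nat_recr//= big_nil !(addnC _ (4 * i)%N).
lra.
Qed.

Lemma expectD n F G : expect n (fun I => F I + G I) = expect n F + expect n G.
Proof. by rewrite -big_split /=; apply: eq_bigr => i _; rewrite mulrDr. Qed.

Lemma expectZ n c F : expect n (fun I => c * F I) = c * expect n F.
Proof. by rewrite mulr_sumr; apply: eq_bigr => i _; rewrite mulrCA. Qed.

Lemma len_gt0 I : 0 < len R I.
Proof. by rewrite invr_gt0 exprn_gt0. Qed.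

Lemma le_expect n F G : (forall I, level I = n -> F I <= G I) ->
  expect n F <= expect n G.
Proof. by move=> FG; apply: ler_sum => i _; rewrite ler_pM2l ?len_gt0 ?FG. Qed.

Lemma eq_expect n F G : (forall I, level I = n -> F I = G I) ->
  expect n F = expect n G.
Proof. by move=> FG; apply: eq_bigr => i _; rewrite FG. Qed.

Lemma expect_ge0 n F : (forall I, 0 <= F I) -> 0 <= expect n F.
Proof. by move=> F0; apply: sumr_ge0 => i _; rewrite mulr_ge0 ?F0// ltW ?len_gt0. Qed.

(** A sum over the whole tree is computed generation by generation, which
    reduces Carleson sums to series of expectations. *)
Lemma esum_level F : (forall I, 0 <= F I) ->
  (\esum_(I in [set: D4]) (len R I * F I)%:E = \sum_(0 <= n <oo) (expect n F)%:E)%E.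
Proof.
move=> F0.
pose L n := [set I | level I = n].
have LT : [set: D4] = \bigcup_n L n.
  by apply/seteqP; split => // I _; exists (level I).
have lF0 I : (0 <= (len R I * F I)%:E)%E.
  by rewrite lee_fin mulr_ge0// ltW// len_gt0.
rewrite LT nneseries_sum_bigcup//; last first.
  by move=> i j _ _ [I [<- <-]].
apply: eq_eseriesr => n _.
have -> : L n = (@generation n) @` [set: 'I_(4 ^ n)].
  apply/seteqP; split => [[k i] /= <-|_ [i _ <-]//]; by exists i.
rewrite esum_image//; last first.
  move=> i j _ _ /(congr1 pos) ij; apply: val_inj; exact: ij.
rewrite esum_fset//; last exact: finite_finset.
have -> : [set: 'I_(4 ^ n)] = [set` index_enum 'I_(4 ^ n)].
  by apply/seteqP; split => // i _ /=; rewrite mem_index_enum.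
by rewrite -fsbig_seq ?index_enum_uniq// sumEFin.
Qed.

End Expectation.

(** * Integrals of step functions *)

Section StepFunctions.
Variable R : realType.
Implicit Types (u F : D4 -> R) (x : R).
Local Notation mu := (@lebesgue_measure R).

(** The interval of generation [m] containing [x], when [x] is in [I0]. *)
Definition cell (m : nat) x : D4 := node m (Num.truncn (x * 4 ^+ m)).

Lemma measurable_I0 : measurable (@I0 R).
Proof. exact: measurable_itv. Qed.

Lemma I0P x : @I0 R x <-> 0 <= x < 1.
Proof. by rewrite /I0 /= in_itv. Qed.

Lemma truncn_cell_lt m x : @I0 R x -> (Num.truncn (x * 4 ^+ m) < 4 ^ m)%N.
Proof.
move=> /I0P/andP[x0 x1].
by rewrite truncn_lt_nat ?mulr_ge0 ?exprn_ge0// natrX gtr_pMl ?exprn_gt0.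
Qed.

Lemma parent_cell m x : @I0 R x -> parent (cell m.+1 x) = cell m x.
Proof.
move=> Ix; have /I0P/andP[x0 x1] := Ix.
rewrite /parent pos_node ?truncn_cell_lt//=; congr node.
apply/esym/truncn_def.
have y0 : 0 <= x * 4 ^+ m.+1 by rewrite mulr_ge0 ?exprn_ge0.
have := truncn_itv y0; set k := Num.truncn _.
have kge : (k %/ 4)%:R * 4 <= k%:R :> R by rewrite -natrM ler_nat leq_divM.
have klt : k.+1%:R <= (k %/ 4).+1%:R * 4 :> R.
  by rewrite -natrM ler_nat ltn_ceil.
rewrite exprS => /andP[kx xk]; apply/andP; split.
  rewrite -(ler_pM2r (ltr0n R 4)) (le_trans kge)// (le_trans kx)//.
  by rewrite [4 * _]mulrC mulrA.
rewrite -(ltr_pM2r (ltr0n R 4)) (lt_le_trans _ klt)//.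
by rewrite (le_lt_trans _ xk)// [4 * _]mulrC mulrA.
Qed.

Lemma itv_sub_I0 I : @itv R I `<=` @I0 R.
Proof.
move=> x; rewrite /itv /= in_itv /= => /andP[ge lt]; apply/I0P/andP; split.
  by apply: le_trans ge; rewrite mulr_ge0// ltW ?len_gt0.
apply: lt_le_trans lt _.
by rewrite /len ler_pdivrMr ?exprn_gt0// mul1r -natrX ler_nat pos_lt.
Qed.

Lemma mem_itv_generation n (i : 'I_(4 ^ n)) x : @I0 R x ->
  (x \in @itv R (generation i)) = (i == Num.truncn (x * 4 ^+ n) :> nat).
Proof.
move=> /I0P/andP[x0 x1]; rewrite eq_sym truncn_eq ?mulr_ge0 ?exprn_ge0//.
by apply/idP/idP; rewrite inE /itv /= in_itv /= /len ler_pdivrMr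
  ?ltr_pdivlMr ?exprn_gt0.
Qed.

Lemma step_fun_cell u n x : @I0 R x -> step_fun u n x = u (cell n x).
Proof.
move=> Ix; rewrite /step_fun.
have lt := truncn_cell_lt n Ix.
rewrite (bigD1 (Ordinal lt))//= indicE mem_itv_generation// eqxx mulr1.
rewrite big1 ?addr0 => [|i ne]; first by rewrite generationE.
move: ne; rewrite -val_eqE /= => /negbTE ne.
by rewrite indicE mem_itv_generation// ne mulr0.
Qed.

Lemma measurable_itvD4 I : measurable (@itv R I).
Proof. exact: measurable_itv. Qed.

Lemma measurable_step_fun (D : set R) u n : measurable_fun D (step_fun u n).
Proof.
apply: measurable_sum => i; apply: measurable_funM => //.
apply: measurable_indic; exact: measurable_itvD4.
Qed.

Lemma lebesgue_itvD4 I : mu (@itv R I) = (len R I)%:E.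
Proof.
rewrite lebesgue_measure_itv/= lte_fin ltr_pM2r ?len_gt0// ltr_nat ltnSn.
by rewrite -EFinB -mulrBl -natrB// subSnn mul1r.
Qed.

(** Lebesgue integrals of step functions are expectations: from here on only
    the limit in [n] involves measure theory. *)
Lemma integral_step_fun F n : (forall I, 0 <= F I) ->
  (\int[mu]_(x in @I0 R) (step_fun F n x)%:E = (expect n F)%:E)%E.
Proof.
move=> F0; rewrite /step_fun; under eq_integral do rewrite -sumEFin.
rewrite ge0_integral_sum//; first last.
- by move=> i x _; rewrite lee_fin mulr_ge0.
- move=> i; apply/measurable_EFinP/measurable_funM => //.
  apply: measurable_indic; exact: measurable_itvD4.
- exact: measurable_I0.
rewrite /expect -sumEFin; apply: eq_bigr => i _.
under eq_integral do rewrite EFinM.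
rewrite (@ge0_integralZl_EFin _ _ R mu _ measurable_I0)//; last first.
  by apply/measurable_EFinP; apply: measurable_indic; exact: measurable_itvD4.
rewrite integral_indic//; [|exact: measurable_I0|exact: measurable_itvD4].
have /setIidl -> := @itv_sub_I0 (generation i).
by rewrite [X in (_ * X)%E]lebesgue_itvD4 -EFinM mulrC.
Qed.

Lemma cell_ancestor m d x : @I0 R x -> iter d parent (cell (m + d) x) = cell m x.
Proof.
move=> Ix; elim: d => [|d IH]; first by rewrite addn0.
by rewrite iterSr addnS parent_cell.
Qed.

(** Orthogonality of martingale increments. By induction on [d]: passing from
    an interval to its children changes the two sides by the same amount,
    because the ancestor's value is constant on the children and they average
    to the value at the interval. *)
Lemma expect_incr_sqr u n d : sliced_martingale u ->
  expect (n + d) (fun I => (u I - u (iter d parent I)) ^+ 2) =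
  expect (n + d) (fun I => u I ^+ 2) - expect n (fun I => u I ^+ 2).
Proof.
move=> su; elim: d => [|d IH].
  by rewrite addn0 subrr /expect big1// => i _; rewrite /= subrr expr0n mulr0.
rewrite addnS !expectS.
set v2 := child_avg (fun I => u I ^+ 2).
rewrite (@eq_expect _ _ _ (fun I => (u I - u (iter d parent I)) ^+ 2
    + (v2 I + (- 1) * u I ^+ 2))) ?expectD ?expectZ ?IH; first by ring.
move=> I _; rewrite /v2 /child_avg !iterSr !parent_child.
have [ux uy] := su I.
have -> : u (xplus I) = 2 * u I - u (xminus I) by rewrite ux; field.
have -> : u (yplus I) = 2 * u I - u (yminus I) by rewrite {1}uy; field.
by field.
Qed.

Lemma expect_sqr_nd u : sliced_martingale u ->
  nondecreasing_seq (fun n => expect n (fun I => u I ^+ 2)).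
Proof.
move=> su m n /subnKC <-; rewrite -subr_ge0 -expect_incr_sqr// expect_ge0// => I.
exact: sqr_ge0.
Qed.

Lemma integral_step_fun_diff u n m : sliced_martingale u -> (n <= m)%N ->
  (\int[mu]_(x in @I0 R) ((step_fun u m x - step_fun u n x) ^+ 2)%:E =
  (expect m (fun I => u I ^+ 2) - expect n (fun I => u I ^+ 2))%:E)%E.
Proof.
move=> su /subnKC <-; rewrite -expect_incr_sqr// -integral_step_fun; last first.
  by move=> I; exact: sqr_ge0.
apply: eq_integral => x /set_mem Ix.
by rewrite !step_fun_cell// cell_ancestor.
Qed.

Lemma integral_step_fun_absdiff u n m : sliced_martingale u -> (n <= m)%N ->
  (\int[mu]_(x in @I0 R) (`|step_fun u m x - step_fun u n x|)%:E =
  (expect m (fun I => `|u I - u (iter (m - n) parent I)|))%:E)%E.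
Proof.
move=> su /subnKC {1 2}<-; rewrite -integral_step_fun//.
apply: eq_integral => x /set_mem Ix.
by rewrite !step_fun_cell// cell_ancestor.
Qed.
End StepFunctions.

(** * Convergence in L^2 and the norm *)

(** The sum of the increments has finite integral, hence is finite almost
    everywhere, and there the telescoping series converges absolutely. Taking
    a limit superior makes the limit measurable without a choice of
    representative. *)
Lemma ae_cvg_summable_increments d (T : measurableType d) (R : realType)
    (mu : {measure set T -> \bar R}) (D : set T) (g : nat -> T -> R) :
  measurable D -> (forall k, measurable_fun D (g k)) ->
  (\sum_(0 <= k <oo) \int[mu]_(x in D) (`|g k.+1 x - g k x|)%:E < +oo)%E ->
  exists2 h : T -> R, measurable_fun D h &
    {ae mu, forall x, D x -> g k x @[k --> \oo] --> h x}.
Proof.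
move=> mD mg gfin.
have mdg k : measurable_fun D (fun x => (`|g k.+1 x - g k x|)%:E).
  apply/measurable_EFinP; apply: measurableT_comp => //.
  exact: measurable_funB.
exists (fun x => fine (limn_esup (fun k => (g k x)%:E))).
  apply: (@measurableT_comp _ _ _ _ _ _ fine); first exact: fine_measurable.
  by apply: measurable_fun_limn_esup => k; exact/measurable_EFinP.
pose s x := (\sum_(0 <= k <oo) (`|g k.+1 x - g k x|)%:E)%E.
have s_int : mu.-integrable D s.
  apply/integrableP; split.
    by apply: ge0_emeasurable_sum => // k x _ _; rewrite lee_fin.
  rewrite (eq_integral s) => [|x _]; last first.
    by rewrite gee0_abs// /s nneseries_ge0// => k _ _; rewrite lee_fin.
  by rewrite /s integral_nneseries// => k x _; rewrite lee_fin.
have := integrable_ae mD s_int.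
apply: filterS => x sfin Dx.
suff gcvg : cvgn (fun k => g k x).
  have Ecvg : ((g k x)%:E @[k --> \oo] --> (limn (fun k => g k x))%:E).
    by apply: cvg_EFin; [exact: nearW|].
  by rewrite (cvg_limn_einf_sup Ecvg).2.
have {}sfin := sfin Dx.
have sc : cvgn [normed series (telescope (fun k => g k x))].
  apply: nondecreasing_is_cvgn.
    by apply: nondecreasing_series => k _ _; exact: normr_ge0.
  exists (fine (s x)) => _ [n _ <-].
  rewrite -lee_fin fineK// /series/= -sumEFin.
  apply: nneseries_lim_ge => k _ _; by rewrite lee_fin.
have := normed_cvg sc; rewrite telescopeK => tc.
have -> : (fun k => g k x) = (fun k => (g k x - g 0%N x) + g 0%N x).
  by apply/funext => k; rewrite subrK.
exact: is_cvgD tc (is_cvg_cst _).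
Qed.

Section L2Limit.
Variable R : realType.
Implicit Types (u v : D4 -> R) (g : R -> R).
Local Notation mu := (@lebesgue_measure R).
Local Notation energy u := (fun n => expect n (fun I => u I ^+ 2)).

Lemma expect_cst n (c : R) : expect n (fun=> c) = c.
Proof.
rewrite expectE big_const_nat subn0 iter_addr addr0 -[c *+ _]mulr_natr natrX mulrCA.
by rewrite mulVf ?mulr1// expf_neq0.
Qed.

(** Cauchy-Schwarz against the constant 1, in the form
    [|y| <= e / 2 + y ^ 2 / (2 e)]. *)
Lemma expect_norm_le n (F : D4 -> R) e : 0 < e ->
  expect n (fun I => F I ^+ 2) <= e ^+ 2 -> expect n (fun I => `|F I|) <= e.
Proof.
move=> e0 Fe.
apply: (@le_trans _ _ (expect n (fun I => e / 2 + (2 * e)^-1 * F I ^+ 2))).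
  apply: le_expect => I _; rewrite -subr_ge0 -(real_normK (num_real (F I))).
  have -> : e / 2 + (2 * e)^-1 * `|F I| ^+ 2 - `|F I| = (e - `|F I|) ^+ 2 / (2 * e).
    by field; rewrite gt_eqF.
  by rewrite divr_ge0 ?sqr_ge0// mulr_ge0// ltW.
rewrite expectD expect_cst expectZ.
have {3}-> : e = e / 2 + (2 * e)^-1 * e ^+ 2 by field; rewrite gt_eqF.
by rewrite lerD2l ler_pM2l// invr_gt0 mulr_gt0.
Qed.

Lemma expect_sqr_cvg u : sliced_martingale u -> L2_integrable u ->
  exists L, [/\ forall n, energy u n <= L, energy u n @[n --> \oo] --> L &
    ereal_sup (range (fun n => (energy u n)%:E)) = L%:E].
Proof.
move=> su L2u; have nd := expect_sqr_nd su.
set S := ereal_sup _.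
have aS n : ((energy u n)%:E <= S)%E by apply: ereal_sup_ubound; exists n.
have Sfin : S \is a fin_num.
  rewrite fin_numElt L2u andbT.
  by apply: lt_le_trans (aS 0%N); rewrite ltNyr.
exists (fine S); split; last by rewrite fineK.
  by move=> n; rewrite -lee_fin fineK.
have : (energy u n)%:E @[n --> \oo] --> S.
  by apply: ereal_nondecreasing_cvgn => m n mn; rewrite lee_fin; exact: nd.
by rewrite -(fineK Sfin) => /fine_cvg.
Qed.

(** A substitute for the triangle inequality in L^2: Young's inequality
    [2 g (f - g) <= e g ^ 2 + (f - g) ^ 2 / e], integrated. As [e] may be taken
    arbitrarily small, it suffices to compare norms along convergent
    sequences. *)
Lemma integral_sqr_young (D : set R) (f g : R -> R) (e : R) :
  measurable D -> measurable_fun D f -> measurable_fun D g -> 0 < e ->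
  (\int[mu]_(x in D) (f x ^+ 2)%:E <=
   (1 + e)%:E * \int[mu]_(x in D) (g x ^+ 2)%:E +
   (1 + e^-1)%:E * \int[mu]_(x in D) ((f x - g x) ^+ 2)%:E)%E.
Proof.
move=> mD mf mg e0.
have ei0 : 0 < e^-1 by rewrite invr_gt0.
have mf2 : measurable_fun D (fun x => (f x ^+ 2)%:E).
  by apply/measurable_EFinP; exact: measurable_funX.
have mg2 : measurable_fun D (fun x => (g x ^+ 2)%:E).
  by apply/measurable_EFinP; exact: measurable_funX.
have md2 : measurable_fun D (fun x => ((f x - g x) ^+ 2)%:E).
  by apply/measurable_EFinP/measurable_funX; exact: measurable_funB.
rewrite -!ge0_integralZl_EFin//; first last.
- by rewrite addr_ge0// ltW.
- by move=> x _; rewrite lee_fin sqr_ge0.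
- by rewrite addr_ge0// ltW.
- by move=> x _; rewrite lee_fin sqr_ge0.
rewrite -ge0_integralD//; first last.
- exact: measurable_funeM.
- by move=> x _; rewrite -EFinM lee_fin mulr_ge0 ?sqr_ge0// addr_ge0// ltW.
- exact: measurable_funeM.
- by move=> x _; rewrite -EFinM lee_fin mulr_ge0 ?sqr_ge0// addr_ge0// ltW.
apply: ge0_le_integral => //.
- by move=> x _; rewrite lee_fin sqr_ge0.
- by apply: emeasurable_funD; exact: measurable_funeM.
move=> x _; rewrite -!EFinM -EFinD lee_fin -subr_ge0.
have -> : (1 + e) * g x ^+ 2 + (1 + e^-1) * (f x - g x) ^+ 2 - f x ^+ 2 =
    e^-1 * (e * g x - (f x - g x)) ^+ 2 by field; rewrite gt_eqF.
by rewrite mulr_ge0 ?sqr_ge0// ltW.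
Qed.

(** Completeness of L^2 for this sequence. Along a subsequence whose
    increments have L^2 norm at most [2 ^ - k.+1] the step functions converge
    almost everywhere; Fatou's lemma then bounds the distance from any step
    function to the limit by the energy still to come, which tends to 0. *)
Lemma L2_limit_exists u : sliced_martingale u -> L2_integrable u ->
  exists g, is_L2_limit u g.
Proof.
move=> su L2u; have [L [aL acvg _]] := expect_sqr_cvg su L2u.
have nd := expect_sqr_nd su.
pose e (k : nat) : R := 1 / (2 ^ k.+1)%:R.
have e0 k : 0 < e k by rewrite divr_gt0// ltr0n expn_gt0.
have /choice[N NP] k : exists N, forall n, (N <= n)%N -> L - energy u n <= e k ^+ 2.
  have e20 : 0 < e k ^+ 2 by rewrite exprn_gt0.
  move/cvgrPdist_le : acvg => /(_ _ e20)[N _ NP]; exists N => n Nn.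
  by rewrite (le_trans (ler_norm _))// NP.
(* Summing the thresholds makes them nondecreasing, and adding k makes them
   tend to infinity, which Fatou's lemma needs below. *)
pose N' k := (k + \sum_(j < k.+1) N j)%N.
have N'N k : (N k <= N' k)%N.
  by rewrite /N' big_ord_recr/= addnA leq_addl.
have kN' k : (k <= N' k)%N by rewrite leq_addr.
have N'S k : (N' k <= N' k.+1)%N.
  by rewrite /N' [in X in (_ <= X)%N]big_ord_recr/= leq_add// leq_addr.
pose g k := step_fun u (N' k).
have mg D k : measurable_fun D (g k) by exact: measurable_step_fun.
have [|||h mh hcvg] := @ae_cvg_summable_increments _ _ R mu (@I0 R) g.
- exact: measurable_I0.
- by move=> k; exact: mg.
- apply: (@le_lt_trans _ _ 1%:E); last by rewrite ltry.
  apply: le_trans (@epsilon_trick0 R 1 xpredT ler01).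
  apply: lee_nneseries => [k _ _|k _].
    by apply: integral_ge0 => x _; rewrite lee_fin.
  rewrite integral_step_fun_absdiff// lee_fin.
  apply: expect_norm_le; first exact: e0.
  have := expect_incr_sqr (N' k) (N' k.+1 - N' k) su; rewrite subnKC// => ->.
  by rewrite (le_trans _ (NP k (N' k) (N'N k)))// lerD2r.
have dist n : (\int[mu]_(x in @I0 R) ((step_fun u n x - h x) ^+ 2)%:E
    <= (L - energy u n)%:E)%E.
  pose f k x := ((step_fun u n x - g k x) ^+ 2)%:E.
  have mf k : measurable_fun (@I0 R) (f k).
    apply/measurable_EFinP/measurable_funX/measurable_funB => //.
    exact: measurable_step_fun.
  have -> : (\int[mu]_(x in @I0 R) ((step_fun u n x - h x) ^+ 2)%:E =
      \int[mu]_(x in @I0 R) limn_einf (f^~ x))%E.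
    apply: ae_eq_integral.
    - exact: measurable_I0.
    - apply/measurable_EFinP/measurable_funX/measurable_funB => //.
      exact: measurable_step_fun.
    - under eq_fun do rewrite -[limn_einf _]oppeK -limn_esupN.
      apply: measurableT_comp => //.
      apply: (@measurable_fun_limn_esup _ _ _ _ (fun k x => (- f k x)%E)) => k.
      by apply: measurableT_comp => //; exact: mf.
    - apply: filterS hcvg => x hx Ix.
      apply/esym; apply: (cvg_limn_einf_sup _).1.
      apply: cvg_EFin; first exact: nearW.
      have c : step_fun u n x - g k x @[k --> \oo] --> step_fun u n x - h x.
        by apply: cvgB; [exact: cvg_cst|exact: hx].
      exact: (cvgM c c).
  have f0 k x : @I0 R x -> (0 <= f k x)%E by move=> _; rewrite lee_fin sqr_ge0.
  apply: (le_trans (fatou mu (@measurable_I0 R) mf f0)).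
  rewrite limn_einf_lim; apply: lime_le; first exact: is_cvg_einfs.
  apply: nearW => k.
  apply: (@le_trans _ _ (\int[mu]_(x in @I0 R) f (maxn k n) x)%E).
    apply: ereal_inf_lbound; exists (maxn k n) => //=.
    exact: leq_maxl.
  rewrite /f.
  under eq_integral do rewrite -sqrrN opprB.
  rewrite integral_step_fun_diff ?lee_fin ?lerD2r//.
  by rewrite (leq_trans _ (kN' _))// leq_maxr.
exists h; split => //.
  have ms := @measurable_step_fun R (@I0 R) u 0%N.
  have Y := integral_sqr_young (@measurable_I0 R) mh ms ltr01.
  apply: (le_lt_trans Y).
  under [X in (_ + _ * X)%E]eq_integral do rewrite -sqrrN opprB.
  apply: (@le_lt_trans _ _ ((1 + 1)%:E * (energy u 0%N)%:E +
    (1 + 1^-1)%:E * (L - energy u 0%N)%:E)%E); last by rewrite -!EFinM -EFinD ltry.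
  apply: leeD; rewrite lee_pmul2l ?lte_fin ?addr_gt0 ?invr_gt0//.
  have Fnn I : 0 <= u I ^+ 2 by exact: sqr_ge0.
  rewrite -(integral_step_fun 0 Fnn) le_eqVlt; apply/orP; left; apply/eqP.
  by apply: eq_integral => x /set_mem Ix; rewrite !step_fun_cell.
apply: (@squeeze_cvge _ _ _ _ (cst 0%E) _ (fun n => (L - energy u n)%:E)).
- apply: nearW => n; rewrite dist andbT.
  by apply: integral_ge0 => x _; rewrite lee_fin sqr_ge0.
- exact: cvg_cst.
- apply: cvg_EFin; first exact: nearW.
  by rewrite -(subrr L); apply: cvgB => //; exact: cvg_cst.
Qed.
End L2Limit.

Section Norm.
Variable R : realType.
Implicit Types (u v : D4 -> R) (g : R -> R).
Local Notation mu := (@lebesgue_measure R).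
Local Notation energy u := (fun n => expect n (fun I => u I ^+ 2)).

(** Norms converge along L^2 convergence: apply [integral_sqr_young] to the
    step function and the limit, in both orders. *)
Lemma integral_L2_limit u g : sliced_martingale u -> L2_integrable u ->
  is_L2_limit u g ->
  (\int[mu]_(x in @I0 R) (g x ^+ 2)%:E = ereal_sup (range (fun n => (energy u n)%:E)))%E.
Proof.
move=> su L2u [mg gfin gcvg].
have [L [aL acvg ->]] := expect_sqr_cvg su L2u.
set G := (\int[mu]_(x in _) _)%E.
have G0 : (0 <= G)%E by apply: integral_ge0 => x _; rewrite lee_fin sqr_ge0.
have Gfin : G \is a fin_num by rewrite ge0_fin_numE.
rewrite -(fineK Gfin); congr EFin.
set r := fine G; have r0 : 0 <= r by exact: fine_ge0.
have L0 : 0 <= L by apply: le_trans (aL 0%N); apply: expect_ge0 => I; exact: sqr_ge0.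
have ms n : measurable_fun (@I0 R) (step_fun u n) by exact: measurable_step_fun.
pose D n := (\int[mu]_(x in @I0 R) ((step_fun u n x - g x) ^+ 2)%:E)%E.
have aE n : (\int[mu]_(x in @I0 R) (step_fun u n x ^+ 2)%:E = (energy u n)%:E)%E.
  rewrite -integral_step_fun; last by move=> I; exact: sqr_ge0.
  by apply: eq_integral => x /set_mem Ix; rewrite !step_fun_cell.
have key e : 0 < e -> L <= (1 + e) * r + e + e /\ r <= (1 + e) * L + e.
  move=> e0; have c0 : 0 < 1 + e^-1 by rewrite addr_gt0// invr_gt0.
  have eta0 : 0 < e / (1 + e^-1) by rewrite divr_gt0.
  move/fine_cvgP : gcvg => [finD cD].
  have [n [Dfin Dn an]] : exists n,
      [/\ D n \is a fin_num, fine (D n) <= e / (1 + e^-1) & L - energy u n <= e].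
    move/cvgrPdist_le : cD => /(_ _ eta0) cD.
    move/cvgrPdist_le : acvg => /(_ _ e0) acvg'.
    have [n _ /(_ n (leqnn n)) [[H1 H2] H3]] := filterI (filterI finD cD) acvg'.
    exists n; split => //.
      by move: H2; rewrite sub0r normrN => /(le_trans (ler_norm _)).
    exact: le_trans (ler_norm _) H3.
  have De : (1 + e^-1) * fine (D n) <= e by rewrite -ler_pdivlMl// mulrC.
  have Y1 := integral_sqr_young (@measurable_I0 R) (ms n) mg e0.
  have Y2 := integral_sqr_young (@measurable_I0 R) mg (ms n) e0.
  have sym : (\int[mu]_(x in @I0 R) ((g x - step_fun u n x) ^+ 2)%:E = D n)%E.
    by apply: eq_integral => x _; rewrite -sqrrN opprB.
  rewrite sym in Y2; rewrite !aE -/G -/(D n) -(fineK Gfin) -(fineK Dfin) in Y1 Y2.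
  rewrite -!EFinM -EFinD lee_fin -/r in Y1; rewrite -!EFinM -EFinD lee_fin -/r in Y2.
  split; first by lra.
  apply: (le_trans Y2); rewrite lerD// ler_pM2l// addr_gt0//.
apply/eqP; rewrite eq_le; apply/andP; split; apply/ler_addgt0Pl => e e0.
  have d0 : 0 < L + 1 by rewrite ltr_wpDl.
  have [_] := key (e / (L + 1)) (divr_gt0 e0 d0).
  suff -> : (1 + e / (L + 1)) * L + e / (L + 1) = e + L by [].
  by field; rewrite gt_eqF.
have d0 : 0 < r + 2 by rewrite ltr_wpDl.
have [+ _] := key (e / (r + 2)) (divr_gt0 e0 d0).
suff -> : (1 + e / (r + 2)) * r + e / (r + 2) + e / (r + 2) = e + r by [].
by field; rewrite gt_eqF.
Qed.

Lemma L2_limitP u : sliced_martingale u -> L2_integrable u ->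
  is_L2_limit u (L2_limit u).
Proof.
move=> su L2u; have [g ug] := L2_limit_exists su L2u.
exact: (xgetPex _ (ex_intro _ g ug)).
Qed.

(** The bridge to the discrete problem: from here on the norm enters only
    through the energies of the generations. *)
Lemma H2dy_sqnormE u v : H2dy u v ->
  H2dy_sqnorm u v =
  ereal_sup (range (fun n => (expect n (fun I => u I ^+ 2 + v I ^+ 2))%:E)).
Proof.
move=> [[su L2u] [sv L2v] _].
have uP := L2_limitP su L2u; have vP := L2_limitP sv L2v.
have [mu' _ _] := uP; have [mv' _ _] := vP.
rewrite /H2dy_sqnorm; under eq_integral do rewrite EFinD.
rewrite ge0_integralD//=; first last.
- by apply/measurable_EFinP; exact: measurable_funX.
- by move=> x _; rewrite lee_fin sqr_ge0.
- by apply/measurable_EFinP; exact: measurable_funX.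
- by move=> x _; rewrite lee_fin sqr_ge0.
- exact: measurable_I0.
rewrite (integral_L2_limit su L2u uP) (integral_L2_limit sv L2v vP).
have [Lu [_ cu ->]] := expect_sqr_cvg su L2u.
have [Lv [_ cv ->]] := expect_sqr_cvg sv L2v.
pose s n := expect n (fun I => u I ^+ 2 + v I ^+ 2).
have s_cvg : (s n)%:E @[n --> \oo] --> (Lu%:E + Lv%:E)%E.
  apply: cvg_EFin; first exact: nearW.
  rewrite (_ : _ \o _ = (fun n => energy u n + energy v n)); first exact: cvgD.
  by apply/funext => n; rewrite /s /= expectD.
have nd : {homo (fun n => (s n)%:E) : m n / (m <= n)%N >-> (m <= n)%E}.
  by move=> m n mn; rewrite lee_fin /s !expectD lerD// expect_sqr_nd.
by have := cvg_unique _ s_cvg (ereal_nondecreasing_cvgn nd); apply.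
Qed.
End Norm.

(** * The Bellman inequality and the upper bound *)

Section UpperBound.
Variable R : realType.
Implicit Types (M u v : D4 -> R) (I : D4).

(** [x] and [s] are the hyperbolic cosine and sine of [ln a]. *)
Lemma cosh_sinh_split (a : R) : 0 < a ->
  exists x s, [/\ a = x + s, a^-1 = x - s, 1 <= x & x ^+ 2 - s ^+ 2 = 1].
Proof.
move=> a0; exists ((a + a^-1) / 2), ((a - a^-1) / 2).
split; [by field; rewrite gt_eqF|by field; rewrite gt_eqF| |by field; rewrite gt_eqF].
rewrite -subr_ge0; have -> : (a + a^-1) / 2 - 1 = (a - 1) ^+ 2 / (2 * a).
  by field; rewrite gt_eqF.
by rewrite divr_ge0 ?sqr_ge0// mulr_ge0// ltW.
Qed.

(** The dyadic form of the subharmonicity of [exp(h) |F| ^ 2] for harmonic [h]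
    and holomorphic [F = f + i g] with derivative [p + i q]. With [x] and [y]
    the two hyperbolic cosines, the minimum over [p + i q] of the right-hand
    side is [(1 + x y) / (x + y)] times [|F| ^ 2], which is at least
    [|F| ^ 2] because [(x - 1) (y - 1) >= 0], and equal to it when [x = 1]
    or [y = 1]. *)
Lemma exp_sqnorm_submean (a b f g p q : R) : 0 < a -> 0 < b ->
  f ^+ 2 + g ^+ 2 <=
  (a * ((f + p) ^+ 2 + (g + q) ^+ 2) + a^-1 * ((f - p) ^+ 2 + (g - q) ^+ 2) +
   b * ((f - q) ^+ 2 + (g + p) ^+ 2) + b^-1 * ((f + q) ^+ 2 + (g - p) ^+ 2)) / 4.
Proof.
move=> /cosh_sinh_split[x [s [-> -> x1 xs]]] /cosh_sinh_split[y [t [-> -> y1 yt]]].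
rewrite ler_pdivlMr// -subr_ge0 -(pmulr_rge0 _ (_ : 0 < (x + y) / 2)); last by lra.
set e := (X in 0 <= X).
(* Completing the square in p + i q; what remains is (cosh - 1)(cosh - 1). *)
have -> : e = ((x + y) * p + s * f + t * g) ^+ 2 + ((x + y) * q + s * g - t * f) ^+ 2
  + (x ^+ 2 - s ^+ 2 + (y ^+ 2 - t ^+ 2) + 2 * x * y - 2 * (x + y)) * (f ^+ 2 + g ^+ 2).
  by rewrite /e; field.
rewrite xs yt; have -> : 1 + 1 + 2 * x * y - 2 * (x + y) = 2 * ((x - 1) * (y - 1)) by ring.
have F0 : 0 <= f ^+ 2 + g ^+ 2 by rewrite addr_ge0 ?sqr_ge0.
have xy0 : 0 <= (x - 1) * (y - 1) by rewrite mulr_ge0 ?subr_ge0.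
by rewrite addr_ge0 ?addr_ge0 ?sqr_ge0// mulr_ge0// mulr_ge0.
Qed.

(** The Bellman function [exp(1 - M / k) |f| ^ 2]. For [0 <= M <= k] it lies
    between [|f| ^ 2] and [e |f| ^ 2]. *)
Definition potential M u v (k : R) I : R :=
  expR (1 - M I / k) * (u I ^+ 2 + v I ^+ 2).

(** The children of [I] see [M] as a martingale around the value [m], lower
    than [M I] by the Laplacian [d]. [exp_sqnorm_submean] handles the
    martingale part, and the drop multiplies the potential by
    [exp(d / k) >= 1 + d / k], where the exponential weight is at least 1. *)
Lemma carleson_potential_step M u v (k : R) I : 0 < k ->
  sliced_supermartingale M -> (forall J, M J <= k) ->
  sliced_martingale u -> sliced_martingale v ->
  Dx u I = Dy v I -> Dy u I = - Dx v I ->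
  potential M u v k I + - laplacian M I / k * (u I ^+ 2 + v I ^+ 2) <=
  child_avg (potential M u v k) I.
Proof.
move=> k0 sM Mk /(_ I)[ux uy] /(_ I)[vx vy] cr1 cr2.
have [Mge Mxy] := sM I.
pose m := (M (xplus I) + M (xminus I)) / 2.
pose p := Dx u I; pose q := Dx v I.
have := @exp_sqnorm_submean (expR (- (Dx M I / k))) (expR (- (Dy M I / k)))
  (u I) (v I) p q (expR_gt0 _) (expR_gt0 _).
move=> sub; rewrite -!expRN !opprK in sub.
have E1 J x : M J = m + x -> expR (1 - M J / k) = expR (1 - m / k) * expR (- (x / k)).
  by move=> ->; rewrite -expRD; congr expR; field; rewrite gt_eqF.
have [d dE] : exists d, d = M I - m by exists (M I - m).
have -> : - laplacian M I = d by rewrite dE /laplacian opprK.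
rewrite /child_avg /potential (E1 (xplus I) (Dx M I)); last by rewrite /m /Dx; field.
rewrite (E1 (xminus I) (- Dx M I)); last by rewrite /m /Dx; field.
rewrite (E1 (yplus I) (Dy M I)); last by rewrite /m Mxy /Dy; field.
rewrite (E1 (yminus I) (- Dy M I)); last by rewrite /m Mxy /Dy; field.
rewrite !mulNr !opprK.
have -> : u (xplus I) = u I + p by rewrite /p /Dx ux; field.
have -> : u (xminus I) = u I - p by rewrite /p /Dx ux; field.
have -> : v (xplus I) = v I + q by rewrite /q /Dx vx; field.
have -> : v (xminus I) = v I - q by rewrite /q /Dx vx; field.
have -> : u (yplus I) = u I - q by rewrite /q -cr2 /Dy uy; field.
have -> : u (yminus I) = u I + q by rewrite -[q]opprK -cr2 /Dy uy; field.
have -> : v (yplus I) = v I + p by rewrite /p cr1 /Dy vy; field.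
have -> : v (yminus I) = v I - p by rewrite /p cr1 /Dy vy; field.
rewrite -!(mulrA (expR (1 - m / k))) -!mulrDr.
apply: (@le_trans _ _ (expR (1 - m / k) * (u I ^+ 2 + v I ^+ 2))); last first.
  by rewrite -mulrA ler_wpM2l ?expR_ge0.
rewrite -mulrDl ler_wpM2r ?addr_ge0 ?sqr_ge0//.
have -> : 1 - m / k = (1 - M I / k) + d / k.
  by rewrite dE; field; rewrite gt_eqF.
have d0 : 0 <= d / k.
  by rewrite divr_ge0 ?(ltW k0)// dE subr_ge0.
have e1 : 1 <= expR (1 - M I / k).
  by rewrite -{1}expR0 ler_expR subr_ge0 ler_pdivrMr// mul1r.
have e2 := expR_ge1Dx (d / k).
rewrite (expRD (1 - M I / k)); move: d0 e1 e2; move: (d / k) (expR (1 - M I / k)) => x y.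
by move: (expR x) => z; nra.
Qed.

(** The potential gains at least one Carleson term per generation, and
    finally it is at most [e |f| ^ 2]. *)
Lemma carleson_partial_sum_le M u v (k : R) n : 0 < k ->
  sliced_supermartingale M -> nonnegative M -> (forall J, M J <= k) ->
  sliced_martingale u -> sliced_martingale v ->
  (forall I, Dx u I = Dy v I /\ Dy u I = - Dx v I) ->
  \sum_(i < n) expect i (fun I => - laplacian M I * (u I ^+ 2 + v I ^+ 2)) <=
  expR 1 * k * expect n (fun I => u I ^+ 2 + v I ^+ 2).
Proof.
move=> k0 sM M0 Mk su sv cr.
pose F I := u I ^+ 2 + v I ^+ 2.
have F0 I : 0 <= F I by rewrite addr_ge0 ?sqr_ge0.
pose Phi := potential M u v k.
have Phi0 J : 0 <= Phi J by apply: mulr_ge0; [exact: expR_ge0|exact: F0].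
have step : \sum_(i < n) expect i (fun I => - laplacian M I * F I) <=
    k * expect n Phi.
  elim: n => [|n IH]; first by rewrite big_ord0 mulr_ge0 ?expect_ge0 ?ltW.
  rewrite big_ord_recr/= expectS.
  apply: le_trans (_ : k * expect n (fun I => Phi I + - laplacian M I / k * F I) <= _).
    rewrite expectD mulrDr lerD// -expectZ le_expect// => I _.
    by rewrite [leRHS]mulrA mulrCA mulfV ?mulr1// gt_eqF.
  rewrite ler_pM2l// le_expect// => I _.
  by have [? ?] := cr I; exact: carleson_potential_step.
apply: le_trans step _.
rewrite [expR 1 * k]mulrC -mulrA ler_pM2l// -expectZ le_expect// => I _.
by rewrite ler_wpM2r ?F0// ler_expR gerBl divr_ge0 ?M0// ltW.
Qed.
End UpperBound.

(** * A random walk that nearly attains the constant *)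

Section Extremal.
Variables (R : realType) (k : nat).
Implicit Types I : D4.
Local Notation K := k.+2.

(** [expR (M I)] for [M I = i / K] is [ratio ^+ i], so that all the weights
    below are powers of one number and all the identities are algebraic. *)
Definition ratio : R := expR K%:R^-1.
Local Notation E := ratio.
(** The hyperbolic tangent of [1 / (2 K)]: for this relative increment of [f]
    the inequality [exp_sqnorm_submean] is an equality when [M] moves by
    [1 / K] on the x side and stays on the y side. *)
Definition jump : R := (E - 1) / (E + 1).
Local Notation t := jump.

(** The state is the height [K M] and the two parts of [f]. From the top height
    [K] the walk first drops by one, which is where the Laplacian acts; then
    the height moves by one on the x children and rests on the y children.
    Height 0 is absorbing. The increment of [f] is [t f] on the x side and
    [i t f] on the y side, as the Cauchy-Riemann equations require. *)
Definition walk_step (s : nat * (R * R)) (j : nat) : nat * (R * R) :=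
  if s.1 == 0%N then s else
  let m := minn s.1 k.+1 in
  let: (a, b) := s.2 in
  match j with
  | 0 => (m, (a + t * b, b - t * a))
  | 1 => (m, (a - t * b, b + t * a))
  | 2 => (m.-1, ((1 - t) * a, (1 - t) * b))
  | _ => (m.+1, ((1 + t) * a, (1 + t) * b))
  end.

Fixpoint walk_rec (n : nat) (I : D4) : nat * (R * R) :=
  if n is n'.+1 then walk_step (walk_rec n' (parent I)) (digit I)
  else (K, (1, 0)).

Definition walk (I : D4) := walk_rec (level I) I.
Definition height I : nat := (walk I).1.
Definition walkM I : R := (height I)%:R / K%:R.
Definition walku I : R := (walk I).2.1.
Definition walkv I : R := (walk I).2.2.
Definition sqmod I : R := walku I ^+ 2 + walkv I ^+ 2.

Lemma walk_child I j : walk (child I j) = walk_step (walk I) j.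
Proof. by rewrite /walk /= parent_child digit_child. Qed.

Lemma walk_root : walk (node 0 0) = (K, (1, 0)).
Proof. by []. Qed.

Lemma height_le I : (height I <= K)%N.
Proof.
suff: forall n J, ((walk_rec n J).1 <= K)%N by apply.
elim=> [|n IH] J //=.
rewrite /walk_step; case: eqP => _; first exact: IH.
case: (walk_rec n _) => i [a b] /=; have := geq_minr i k.+1.
by case: (digit J) => [|[|[|?]]] /=; lia.
Qed.

Lemma walk_children I : (0 < height I)%N ->
  let m := minn (height I) k.+1 in
  [/\ walk (xplus I) = (m.+1, ((1 + t) * walku I, (1 + t) * walkv I)),
      walk (xminus I) = (m.-1, ((1 - t) * walku I, (1 - t) * walkv I)),
      walk (yplus I) = (m, (walku I - t * walkv I, walkv I + t * walku I)) &
      walk (yminus I) = (m, (walku I + t * walkv I, walkv I - t * walku I))].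
Proof.
rewrite /height /walku /walkv lt0n => i0.
rewrite /xplus /xminus /yplus /yminus !walk_child /walk_step (negbTE i0).
by case: (walk I).2.
Qed.

Lemma walk_children0 I : height I = 0%N ->
  [/\ walk (xplus I) = walk I, walk (xminus I) = walk I,
      walk (yplus I) = walk I & walk (yminus I) = walk I].
Proof.
rewrite /height => i0.
by rewrite /xplus /xminus /yplus /yminus !walk_child /walk_step i0.
Qed.

Lemma walku_martingale : sliced_martingale walku.
Proof.
move=> I; case: (posnP (height I)) => [/walk_children0|/walk_children] [].
  by rewrite /walku => -> -> -> ->; split; field.
by rewrite /walku /walkv => -> -> -> -> /=; split; field.
Qed.

Lemma walkv_martingale : sliced_martingale walkv.
Proof.
move=> I; case: (posnP (height I)) => [/walk_children0|/walk_children] [].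
  by rewrite /walkv => -> -> -> ->; split; field.
by rewrite /walku /walkv => -> -> -> -> /=; split; field.
Qed.

Lemma walk_CauchyRiemann I :
  Dx walku I = Dy walkv I /\ Dy walku I = - Dx walkv I.
Proof.
case: (posnP (height I)) => [/walk_children0|/walk_children] [].
  by rewrite /Dx /Dy /walku /walkv => -> -> -> ->; split; field.
by rewrite /Dx /Dy /walku /walkv => -> -> -> -> /=; split; field.
Qed.

Lemma height_avg m : (0 < m)%N -> ((m.+1)%:R + (m.-1)%:R) / 2 = m%:R :> R.
Proof. by case: m => // m _; rewrite /= -[m.+2]addn2 -[m.+1]addn1 !natrD; field. Qed.

Lemma min_gt0 i : (0 < i)%N -> (0 < minn i k.+1)%N.
Proof. by move=> i0; rewrite leq_min i0. Qed.

Lemma walkM_xavg I : (walkM (xplus I) + walkM (xminus I)) / 2 =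
  (minn (height I) k.+1)%:R / K%:R.
Proof.
rewrite /walkM /height; case: (posnP (height I)) => [i0|ipos].
  have [-> -> _ _] := walk_children0 i0.
  by move: i0; rewrite /height => ->; rewrite min0n; field.
have [-> -> _ _] := walk_children ipos.
by rewrite -(height_avg (min_gt0 ipos)) /=; field.
Qed.

Lemma walkM_yavg I : (walkM (yplus I) + walkM (yminus I)) / 2 =
  (minn (height I) k.+1)%:R / K%:R.
Proof.
rewrite /walkM /height; case: (posnP (height I)) => [i0|ipos].
  have [_ _ -> ->] := walk_children0 i0.
  by move: i0; rewrite /height => ->; rewrite min0n; field.
have [_ _ -> ->] := walk_children ipos.
by rewrite /=; field.
Qed.

Lemma walkM_supermartingale : sliced_supermartingale walkM.
Proof.
move=> I; rewrite walkM_xavg walkM_yavg; split => //.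
by rewrite /walkM ler_pM2r ?invr_gt0// ler_nat geq_minl.
Qed.

Lemma walkM_laplacian I : - laplacian walkM I = (height I == K)%:R / K%:R.
Proof.
rewrite /laplacian opprK walkM_xavg /walkM -mulrBl; congr (_ / _).
have := height_le I; rewrite leq_eqVlt; case: eqP => [-> _|_ /= lt].
  by rewrite (minn_idPr _)// -natrB// subSnn.
by rewrite (minn_idPl _)// subrr.
Qed.

Lemma walkM_sup_norm : sup_norm walkM = 1%:E.
Proof.
have K0 : 0 < K%:R :> R by [].
apply/eqP; rewrite eq_le; apply/andP; split; last first.
  apply: ereal_sup_ubound; exists (node 0 0) => //.
  by rewrite /walkM /height walk_root/= divff ?gt_eqF// normr1.
apply: ge_ereal_sup => _ [I _ <-]; rewrite lee_fin ger0_norm ?divr_ge0//.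
by rewrite ler_pdivrMr// mul1r ler_nat height_le.
Qed.

(** [|f| ^ 2] times the weight [exp(1 - M)], which makes the potential neither
    grow nor shrink while the height is strictly between 0 and [K]. Under the
    measure with this density the height is a lazy symmetric random walk, and
    [phi] is a test function on its states. *)
Definition weighted (phi : nat -> R) I : R :=
  E ^+ (K - height I) * phi (height I) * sqmod I.

(** The transition operator of the height under this measure; it is not
    normalised at the top, where the factor [E] is the growth caused by the
    drop. *)
Definition drift (phi : nat -> R) (i : nat) : R :=
  if i == 0%N then phi 0%N else
  let m := minn i k.+1 in
  E ^+ (i - m) * ((1 + t ^+ 2) / 2 * phi m + (1 - t ^+ 2) / 4 * (phi m.+1 + phi m.-1)).

Lemma ratio_gt0 : 0 < E. Proof. exact: expR_gt0. Qed.

(** With [1 + t = 2 E / (E + 1)] and [1 - t = 2 / (E + 1)], both x children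
    receive the same weight once the factors [E] are accounted for. *)
Lemma weighted_child_avg phi I :
  child_avg (weighted phi) I = weighted (drift phi) I.
Proof.
rewrite /child_avg /weighted /sqmod /walku /walkv /height.
case: (posnP (height I)) => [i0|ipos].
  have [-> -> -> ->] := walk_children0 i0.
  by move: i0; rewrite /height => ->; rewrite /drift eqxx; field.
have [-> -> -> ->] := walk_children ipos.
rewrite /drift -/(height I) gtn_eqF//=.
have iK := height_le I.
have := min_gt0 ipos; have := geq_minr (height I) k.+1.
have := geq_minl (height I) k.+1.
rewrite /walku /walkv; move: (walk I).2.1 (walk I).2.2 => a b.
move: (minn _ _) => m mi mk m0.
have e2 : (K - m = (K - m.+1).+1)%N by lia.
have e3 : (K - m.-1 = (K - m.+1).+2)%N by lia.
rewrite e2 e3 /=.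
have -> : E ^+ (K - height I) * (E ^+ (height I - m) * ((1 + t ^+ 2) / 2 * phi m +
    (1 - t ^+ 2) / 4 * (phi m.+1 + phi m.-1))) =
  E ^+ (K - m.+1).+1 * ((1 + t ^+ 2) / 2 * phi m +
    (1 - t ^+ 2) / 4 * (phi m.+1 + phi m.-1)).
  by rewrite mulrA -exprD; congr (E ^+ _ * _); lia.
rewrite !exprS /jump; move: (E ^+ _) => w.
have := ratio_gt0; move: E => e e0.
by field; rewrite gt_eqF// addr_gt0.
Qed.

Lemma ratio_exp : E ^+ K = expR 1.
Proof. by rewrite /ratio -expRM_natl mulfV. Qed.

(** What the mean height loses per unit of mass at the top. It is of order
    [1 / (2 K)]: the drop by one is almost compensated by the growth [E]. *)
Definition gap : R := K%:R - E * k.+1%:R.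
Local Notation lam := gap.

Lemma ratio_gt1 : 1 < E.
Proof. by rewrite /ratio expR_gt1 invr_gt0. Qed.

(** This is [exp(- x) > 1 - x] at [x = 1 / K]. *)
Lemma gap_gt0 : 0 < lam.
Proof.
have K0 : 0 < K%:R :> R by [].
have : 1 + - K%:R^-1 < expR (- K%:R^-1) :> R.
  by apply: expR_gt1Dx; rewrite oppr_eq0 invr_eq0 gt_eqF.
rewrite expRN -/ratio -(ltr_pM2r ratio_gt0) mulVf ?gt_eqF ?ratio_gt0//.
rewrite -(ltr_pM2r K0) mul1r -mulrA mulrCA /gap.
have -> : (1 - K%:R^-1) * K%:R = k.+1%:R :> R.
  by rewrite mulrBl mulVf ?gt_eqF// mul1r -[k.+2]addn1 natrD addrK.
by rewrite subr_gt0.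
Qed.

Lemma gap_le : lam <= K%:R^-1.
Proof.
have K0 : 0 < K%:R :> R by [].
have h := expR_ge1Dx (K%:R^-1 : R); rewrite -/ratio in h.
have k1 : (1 + K%:R^-1) * k.+1%:R = K%:R - K%:R^-1 :> R.
  have -> : k.+1%:R = K%:R - 1 :> R by rewrite -[k.+2]addn1 natrD addrK.
  by field; rewrite gt_eqF.
have : (1 + K%:R^-1) * k.+1%:R <= E * k.+1%:R by rewrite ler_wpM2r.
by rewrite k1 /gap lerBlDr addrC -lerBlDr.
Qed.

Lemma jump_bounds : 0 < t < 1.
Proof.
have E1 := ratio_gt1; have E0 : 0 < E + 1 by rewrite addr_gt0// ratio_gt0.
by rewrite /jump divr_gt0 ?subr_gt0//= ltr_pdivrMr// mul1r; lra.
Qed.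

Local Notation q := ((1 - t ^+ 2) / 2).

Lemma move_prob_gt0 : 0 < q.
Proof. by have /andP[t0 t1] := jump_bounds; nra. Qed.

Lemma drift1 i : (i <= K)%N -> drift (fun=> 1) i = 1 + (E - 1) * (i == K)%:R.
Proof.
rewrite leq_eqVlt => /predU1P[->|iK]; rewrite /drift.
  by rewrite /= (minn_idPr _)// subSnn eqxx /= expr1; field.
rewrite (ltn_eqF iK) (minn_idPl _)// subnn.
by case: (i == 0%N) => /=; field.
Qed.

Lemma drift_id i : (i <= K)%N ->
  drift (fun i => i%:R) i = i%:R - lam * (i == K)%:R.
Proof.
rewrite leq_eqVlt => /predU1P[->|iK]; rewrite /drift.
  rewrite /= (minn_idPr _)// subSnn eqxx /= expr1 /gap.
  by rewrite -[k.+2]addn2 -[k.+1]addn1 !natrD; field.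
rewrite (ltn_eqF iK) (minn_idPl _)// subnn.
case: i iK => [|i] _ /=; first by field.
by rewrite -[i.+2]addn2 -[i.+1]addn1 !natrD; field.
Qed.

(** The second moment increases by the variance [q] of a step as long as the
    walk is alive; the crude error term only matters at the top. *)
Lemma drift_sqr_ge i : (i <= K)%N ->
  i%:R ^+ 2 + q * (0 < i)%:R - (K%:R ^+ 2 + 1) * (i == K)%:R <=
  drift (fun i => i%:R ^+ 2) i.
Proof.
have q0 := move_prob_gt0; have /andP[t0 t1] := jump_bounds.
rewrite leq_eqVlt => /predU1P[->|iK]; rewrite /drift.
  rewrite /= (minn_idPr _)// subSnn eqxx /=.
  apply: (@le_trans _ _ 0); first by nra.
  apply: mulr_ge0; first by rewrite exprn_ge0// ltW// ratio_gt0.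
  by rewrite addr_ge0// mulr_ge0 ?addr_ge0 ?sqr_ge0//; nra.
rewrite (ltn_eqF iK) (minn_idPl _)// subnn mulr0 subr0.
case: i iK => [|i] _ /=; first by rewrite mulr0 addr0.
by rewrite -[i.+2]addn2 -[i.+1]addn1 !natrD; nra.
Qed.

Local Notation mom phi n := (expect n (weighted phi)).

Lemma weighted_le (phi psi : nat -> R) I :
  (forall i, (i <= K)%N -> phi i <= psi i) -> weighted phi I <= weighted psi I.
Proof.
move=> le; rewrite /weighted ler_wpM2r ?addr_ge0 ?sqr_ge0//.
by rewrite ler_wpM2l ?le ?height_le// exprn_ge0// ltW// ratio_gt0.
Qed.

Lemma mom_le (phi psi : nat -> R) n :
  (forall i, (i <= K)%N -> phi i <= psi i) -> mom phi n <= mom psi n.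
Proof. by move=> le; apply: le_expect => I _; exact: weighted_le. Qed.

Lemma eq_mom (phi psi : nat -> R) n :
  (forall i, (i <= K)%N -> phi i = psi i) -> mom phi n = mom psi n.
Proof.
by move=> e; apply: eq_expect => I _; rewrite /weighted e// height_le.
Qed.

Lemma momS phi n : mom phi n.+1 = mom (drift phi) n.
Proof. by rewrite expectS; apply: eq_expect => I _; rewrite weighted_child_avg. Qed.

Lemma momD phi psi n : mom (fun i => phi i + psi i) n = mom phi n + mom psi n.
Proof.
by rewrite -expectD; apply: eq_expect => I _; rewrite /weighted /= [X in X * _]mulrDr mulrDl.
Qed.

Lemma momZ c phi n : mom (fun i => c * phi i) n = c * mom phi n.
Proof.
by rewrite -expectZ; apply: eq_expect => I _; rewrite /weighted /= mulrCA !mulrA.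
Qed.

Lemma mom0 phi : mom phi 0 = phi K.
Proof.
rewrite expect0 /weighted /height /sqmod /walku /walkv walk_root /= subnn.
by rewrite expr0 expr1n expr0n /=; ring.
Qed.

Lemma mom_ge0 phi n : (forall i, (i <= K)%N -> 0 <= phi i) -> 0 <= mom phi n.
Proof.
move=> p0; apply: (@le_trans _ _ (mom (fun=> 0 * 0) n)); last first.
  by apply: mom_le => i iK; rewrite mul0r p0.
by rewrite momZ mul0r.
Qed.

Local Notation top := (fun i => (i == K)%:R : R).
Local Notation alive := (fun i => (0 < i)%N%:R : R).
Local Notation topsum n := (\sum_(m < n) mom top m).

Lemma mom_one n : mom (fun=> 1) n = 1 + (E - 1) * topsum n.
Proof.
elim: n => [|n IH]; first by rewrite mom0 big_ord0 mulr0 addr0.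
by rewrite momS (eq_mom _ drift1) momD momZ IH big_ord_recr/= mulrDr addrA.
Qed.

Lemma mom_id n : mom (fun i => i%:R) n = K%:R - lam * topsum n.
Proof.
elim: n => [|n IH]; first by rewrite mom0 big_ord0 mulr0 subr0.
rewrite momS (@eq_mom _ (fun i => i%:R + (- lam) * top i)); last first.
  by move=> i iK; rewrite drift_id// mulNr.
by rewrite momD momZ IH big_ord_recr/=; ring.
Qed.

Lemma mom_sqr_ge n :
  K%:R ^+ 2 + q * (\sum_(m < n) mom alive m) - (K%:R ^+ 2 + 1) * topsum n <=
  mom (fun i => i%:R ^+ 2) n.
Proof.
elim: n => [|n IH]; first by rewrite mom0 !big_ord0 !mulr0 addr0 subr0.
rewrite momS.
apply: (@le_trans _ _ (mom (fun i => i%:R ^+ 2 +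
    (q * alive i + (- (K%:R ^+ 2 + 1)) * top i)) n)).
  by rewrite !momD !momZ !big_ord_recr/=; lra.
apply: mom_le => i iK; apply: le_trans (drift_sqr_ge iK).
by rewrite mulNr addrA.
Qed.

Lemma topsum_le n : topsum n <= K%:R / lam.
Proof.
rewrite ler_pdivlMr ?gap_gt0// mulrC -subr_ge0 -mom_id.
by apply: mom_ge0.
Qed.

(** The second moment is at most [K ^ 2] and the error at the top is controlled
    by [topsum_le], so the total mass alive over all generations is finite. *)
Lemma alive_sum_le n :
  q * (\sum_(m < n) mom alive m) <= (K%:R ^+ 2 + 1) * (K%:R / lam).
Proof.
have := mom_sqr_ge n.
have : mom (fun i => i%:R ^+ 2) n <= K%:R * mom (fun i => i%:R) n.
  rewrite -momZ; apply: mom_le => i iK; rewrite expr2 ler_wpM2r//.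
  by rewrite ler_nat.
rewrite mom_id.
have T0 : 0 <= topsum n by apply: sumr_ge0 => m _; apply: mom_ge0.
have T1 : (K%:R ^+ 2 + 1) * topsum n <= (K%:R ^+ 2 + 1) * (K%:R / lam).
  by rewrite ler_wpM2l ?addr_ge0 ?sqr_ge0// topsum_le.
have T2 : 0 <= K%:R * (lam * topsum n) by rewrite !mulr_ge0// ltW// gap_gt0.
by rewrite mulrBr; lra.
Qed.

(** Absorption at 0 is almost sure: the mean height is at most [K] times the
    mass alive, which is summable. *)
Lemma mom_id_small e : 0 < e -> exists n, mom (fun i => i%:R) n <= e.
Proof.
move=> e0; pose C := K%:R * ((K%:R ^+ 2 + 1) * (K%:R / lam) / q).
pose n := (Num.truncn (C / e)).+1.
exists n.
(* The mean height is nonincreasing in n, hence at most 1/n times its sum. *)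
have nC : C <= n%:R * e by rewrite -ler_pdivrMr// ltW// truncnS_gt.
have n0 : 0 < n%:R :> R by rewrite ltr0n.
rewrite -(ler_pM2l n0); apply: le_trans nC.
apply: (@le_trans _ _ (\sum_(m < n) mom (fun i => i%:R) m)).
  rewrite mulr_natl -[X in _ *+ X]card_ord -sumr_const.
  apply: ler_sum => m _; rewrite !mom_id lerD2l lerN2 ler_pM2l ?gap_gt0//.
  rewrite -!(big_mkord xpredT (fun m => mom top m)).
  by rewrite (big_cat_nat _ (ltnW (ltn_ord m)))//= lerDl sumr_ge0// => j _; apply: mom_ge0.
apply: (@le_trans _ _ (K%:R * \sum_(m < n) mom alive m)).
  rewrite mulr_sumr; apply: ler_sum => m _; rewrite -momZ.
  apply: mom_le => -[|i] iK /=; first by rewrite mulr0.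
  by rewrite mulr1 ler_nat.
rewrite /C ler_pM2l// ler_pdivlMr ?move_prob_gt0// mulrC.
exact: alive_sum_le.
Qed.

(** A linear bound for the exponential [E ^+ i], with a slope chosen so that
    [topsum] cancels in [expect_sqmod_le]. *)
Lemma ratio_pow_le i : expR 1 <= K%:R :> R -> (i <= K)%N ->
  E ^+ i <= 1 + (E - 1) / lam * i%:R.
Proof.
move=> eK; have E1 := ratio_gt1.
have lam0 := gap_gt0.
have E1l : 0 <= (E - 1) / lam by apply: divr_ge0; [rewrite subr_ge0|]; exact: ltW.
have el : expR 1 <= lam^-1.
  apply: (le_trans eK); rewrite -[leLHS]invrK lef_pV2 ?posrE ?invr_gt0//.
  exact: gap_le.
elim: i => [|i IH] iK; first by rewrite expr0 mulr0 addr0.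
have Ei : E ^+ i <= lam^-1.
  apply: le_trans el; rewrite -ratio_exp ler_weXn2l ?(ltW E1)//; exact: ltnW.
have := IH (ltnW iK); rewrite exprS.
have : (E - 1) * E ^+ i <= (E - 1) / lam by rewrite ler_wpM2l// subr_ge0 ltW.
by rewrite -[i.+1]addn1 natrD mulrDr mulr1; lra.
Qed.

(** [expR 1 * sqmod] exceeds the weighted mass by the factor [E ^+ height];
    [ratio_pow_le] bounds this factor by a linear function of the height whose
    moment is independent of [n] by [mom_one] and [mom_id]. *)
Lemma expect_sqmod_le n : expR 1 <= K%:R :> R ->
  expect n sqmod <= E / (lam * expR 1).
Proof.
move=> eK; have lam0 := gap_gt0; have e0 : 0 < expR 1 :> R by exact: expR_gt0.
rewrite invfM mulrA ler_pdivlMr// mulrC -expectZ.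
apply: (@le_trans _ _ (mom (fun i => 1 + (E - 1) / lam * i%:R) n)).
  apply: le_expect => I _; rewrite /weighted ler_wpM2r ?addr_ge0 ?sqr_ge0//.
  rewrite -ratio_exp -{1}(subnK (height_le I)) exprD.
  apply: ler_wpM2l; first by rewrite exprn_ge0// ltW// ratio_gt0.
  exact: ratio_pow_le (height_le I).
rewrite momD momZ mom_one mom_id.
have -> : 1 + (E - 1) * topsum n + (E - 1) / lam * (K%:R - lam * topsum n) =
    (lam + (E - 1) * K%:R) / lam by field; rewrite gt_eqF.
have -> : lam + (E - 1) * K%:R = E.
  by rewrite /gap -[k.+2]addn2 -[k.+1]addn1 !natrD; ring.
by [].
Qed.

(** Only intervals at the top carry mass of the Carleson sequence, and there
    the weight [E ^+ (K - height)] is 1. *)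
Lemma walk_carleson_partial_sum n :
  \sum_(m < n) expect m (fun I => - laplacian walkM I * sqmod I) = topsum n / K%:R.
Proof.
rewrite mulr_suml; apply: eq_bigr => m _; rewrite [RHS]mulrC -expectZ.
apply: eq_expect => I _; rewrite walkM_laplacian /weighted.
case: eqP => [->|_] /=; first by rewrite subnn expr0 !mul1r.
by rewrite mulr0 !mul0r mulr0.
Qed.

End Extremal.

(** * The embedding and its sharpness *)

Section Embedding.
Variable R : realType.
Implicit Types (M u v : D4 -> R) (I : D4).

Lemma oppr_laplacian_ge0 M I : sliced_supermartingale M -> 0 <= - laplacian M I.
Proof. by move=> sM; rewrite /laplacian opprK subr_ge0; exact: (sM I).1. Qed.

Lemma embedding_sumE M u v : sliced_supermartingale M ->
  embedding_sum M u v = (\sum_(0 <= n <oo)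
    (expect n (fun I => - laplacian M I * (u I ^+ 2 + v I ^+ 2)))%:E)%E.
Proof.
move=> sM; rewrite -esum_level => [|I]; last first.
  by rewrite mulr_ge0 ?oppr_laplacian_ge0// addr_ge0 ?sqr_ge0.
by apply: eq_esum => I _; rewrite /carleson_seq mulrA.
Qed.

Lemma embedding_upper M u v : sliced_supermartingale M -> nonnegative M ->
  bounded_family M -> H2dy u v ->
  (embedding_sum M u v <= (expR 1)%:E * sup_norm M * H2dy_sqnorm u v)%E.
Proof.
move=> sM M0 bM Huv; have [[su _] [sv _] cr] := Huv.
have Mle I : ((M I)%:E <= sup_norm M)%E.
  by apply: ereal_sup_ubound; exists I => //; rewrite ger0_norm.
have S0 : (0 <= sup_norm M)%E by apply: le_trans (Mle (node 0 0)); rewrite lee_fin M0.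
have Sfin : sup_norm M \is a fin_num by rewrite ge0_fin_numE.
have {}Mle I : M I <= fine (sup_norm M) by rewrite -lee_fin fineK.
rewrite embedding_sumE//; rewrite -(fineK Sfin).
have := fine_ge0 S0; rewrite le_eqVlt => /predU1P[k0|k0].
  (* Here M = 0, and M / k is not available. *)
  rewrite -k0 mule0 mul0e eseries0// => n _ _; congr EFin.
  have M00 I : M I = 0 by apply/eqP; rewrite eq_le M0 andbT k0.
  by apply: big1 => i _; rewrite /laplacian !M00 addr0 mul0r subrr !oppr0 mul0r mulr0.
rewrite -EFinM; apply: lime_le.
  apply: is_cvg_nneseries => n _ _; rewrite lee_fin expect_ge0// => I.
  by rewrite mulr_ge0 ?oppr_laplacian_ge0// addr_ge0 ?sqr_ge0.
apply: nearW => n; rewrite sumEFin big_mkord.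
apply: (@le_trans _ _ (expR 1 * fine (sup_norm M) *
    expect n (fun I => u I ^+ 2 + v I ^+ 2))%:E).
  by rewrite lee_fin carleson_partial_sum_le.
rewrite [leLHS]EFinM lee_pmul2l ?lte_fin ?mulr_gt0 ?expR_gt0// H2dy_sqnormE//.
by apply: ereal_sup_ubound; exists n.
Qed.

(** The squared norm of [f] is at most [ratio / (e lam)] and the Carleson sum
    is [1 / lam], so the walk excludes every constant below [e / ratio]. *)
Lemma exists_grid (C : R) : 0 <= C -> C < expR 1 ->
  exists k, expR 1 <= k.+2%:R :> R /\ C * ratio R k < expR 1.
Proof.
move=> C0 Ce.
have e0 : 0 < expR 1 :> R by exact: expR_gt0.
have d0 : 0 < expR 1 - C by rewrite subr_gt0.
pose b := expR 1 + expR 1 / (expR 1 - C).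
have q0 : 0 < expR 1 / (expR 1 - C) by rewrite divr_gt0.
have := truncnS_gt b; set k := Num.truncn b => bk; exists k.
have kk : k.+1%:R < k.+2%:R :> R by rewrite ltr_nat.
have K0 : 0 < k.+2%:R :> R by [].
split; first by rewrite /b in bk; lra.
have r0 := ratio_gt0 R k.
have rV : 1 - k.+2%:R^-1 <= (ratio R k)^-1.
  by rewrite /ratio -expRN; exact: expR_ge1Dx.
rewrite -ltr_pdivlMr//; apply: lt_le_trans (ler_wpM2l (ltW e0) rV).
rewrite mulrBr mulr1 ltrBrDl -ltrBrDr.
rewrite ltr_pdivrMr// mulrC -ltr_pdivrMr//.
by rewrite /b in bk; lra.
Qed.

(** Let the height be almost absorbed at 0: then the Carleson partial sum is
    almost [1 / lam]. *)
Lemma embedding_sharp (C : R) : C < expR 1 ->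
  exists M, [/\ sliced_supermartingale M, nonnegative M & bounded_family M] /\
  exists u v, H2dy u v /\
    (embedding_sum M u v > C%:E * sup_norm M * H2dy_sqnorm u v)%E.
Proof.
move=> Ce.
have C'e : Num.max C 0 < expR 1 by rewrite gt_max Ce expR_gt0.
have C0 : 0 <= Num.max C 0 by rewrite le_max lexx orbT.
have CC' : C <= Num.max C 0 by rewrite le_max lexx.
have [k [eK CE]] := exists_grid C0 C'e.
(* Only D = max(C, 0) is used below, as monotonicity of the product in the norm
   needs a non-negative factor. *)
move: (Num.max C 0) C'e CE C0 CC' => D De DE D0 CD.
exists (walkM R k); split.
  split; [exact: walkM_supermartingale| |].
    by move=> I; rewrite divr_ge0.
  by rewrite /bounded_family walkM_sup_norm ltry.
exists (walku R k), (walkv R k).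
have e0 : 0 < expR 1 :> R by exact: expR_gt0.
have lam0 := gap_gt0 R k; set lam := gap R k in lam0.
pose B := ratio R k / (lam * expR 1).
have AB n : expect n (fun I => walku R k I ^+ 2 + walkv R k I ^+ 2) <= B.
  exact: expect_sqmod_le.
have L2 (w : D4 -> R) :
    (forall I, w I ^+ 2 <= walku R k I ^+ 2 + walkv R k I ^+ 2) -> L2_integrable w.
  move=> le; apply: (@le_lt_trans _ _ B%:E); last exact: ltry.
  apply: ge_ereal_sup => _ [n _ <-]; rewrite lee_fin; apply: le_trans (AB n).
  exact: (@le_expect R n (fun I => w I ^+ 2) _ (fun I _ => le I)).
have H : H2dy (walku R k) (walkv R k).
  split; last exact: walk_CauchyRiemann.
    split; first exact: walku_martingale.
    by apply: L2 => I; rewrite lerDl sqr_ge0.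
  split; first exact: walkv_martingale.
  by apply: L2 => I; rewrite lerDr sqr_ge0.
split => //; rewrite walkM_sup_norm mule1 embedding_sumE; last exact: walkM_supermartingale.
have nB : (H2dy_sqnorm (walku R k) (walkv R k) <= B%:E)%E.
  by rewrite H2dy_sqnormE//; apply: ge_ereal_sup => _ [n _ <-]; rewrite lee_fin.
have n0 : (0 <= H2dy_sqnorm (walku R k) (walkv R k))%E.
  by apply: integral_ge0 => x _; rewrite lee_fin addr_ge0 ?sqr_ge0.
apply: (@le_lt_trans _ _ (D * B)%:E).
  apply: (@le_trans _ _ (D%:E * H2dy_sqnorm (walku R k) (walkv R k))%E).
    by rewrite lee_wpmul2r// lee_fin.
  by rewrite EFinM lee_wpmul2l// lee_fin.
(* The sum over all levels is 1 / lam, while D B = theta / lam with theta < 1. *)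
pose theta := D * ratio R k / expR 1.
have th1 : theta < 1 by rewrite ltr_pdivrMr// mul1r.
have DB : D * B = theta / lam.
  by rewrite /B /theta; field; rewrite !gt_eqF.
have K0 : 0 < k.+2%:R :> R by [].
have eps0 : 0 < k.+2%:R * (1 - theta) / 2 by rewrite divr_gt0// mulr_gt0// subr_gt0.
have [n hn] := mom_id_small k eps0.
have := walk_carleson_partial_sum R k n.
rewrite mom_id -/lam in hn.
set T := \sum_(m < n) _ in hn * => pT.
have Tgt : theta / lam < T / k.+2%:R.
  rewrite ltr_pdivrMr// mulrAC ltr_pdivlMr// mulrC [T * _]mulrC.
  have : 0 < k.+2%:R * (1 - theta) by rewrite mulr_gt0// subr_gt0.
  by lra.
apply: (@lt_le_trans _ _ (T / k.+2%:R)%:E); first by rewrite lte_fin DB.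
rewrite -pT -sumEFin -(big_mkord xpredT (fun m => (expect m (fun I =>
  - laplacian (walkM R k) I * sqmod R k I))%:E)).
apply: nneseries_lim_ge => m _ _; rewrite lee_fin expect_ge0// => I.
rewrite mulr_ge0 ?addr_ge0 ?sqr_ge0// oppr_laplacian_ge0//.
exact: walkM_supermartingale.
Qed.
End Embedding.

Theorem theorem2 (R : realType) :
  (forall M : D4 -> R,
     sliced_supermartingale M -> nonnegative M -> bounded_family M ->
   forall u v : D4 -> R, H2dy u v ->
     (embedding_sum M u v <= (expR 1)%:E * sup_norm M * H2dy_sqnorm u v)%E)
  /\
  (forall C : R, C < expR 1 ->
   exists M : D4 -> R,
     [/\ sliced_supermartingale M, nonnegative M & bounded_family M] /\
   exists u v : D4 -> R,
     H2dy u v /\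
     (embedding_sum M u v > C%:E * sup_norm M * H2dy_sqnorm u v)%E).
Proof.
split; last exact: embedding_sharp.
by move=> M sM M0 bM u v; exact: embedding_upper.
Qed.
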